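(* For all $\Delta,r\in\mathbb{N}$ with $r\ge 1$ and all sufficiently large $n\in\mathbb{N}$ (depending on $\Delta$ and $r$), there exists an $n$-vertex graph $G$ that is $\mathcal{T}(n,\Delta)$-universal and contains no odd cycle of length at most $2r+1$. Moreover, $G$ can be explicitly constructed.
   Context: All graphs are finite and simple. $\mathcal{T}(n,\Delta)$ is the family of all $n$-vertex trees with maximum degree at most $\Delta$. A graph $G$ is $\mathcal{T}(n,\Delta)$-universal if it contains every $T\in\mathcal{T}(n,\Delta)$ as a (not necessarily induced) subgraph. ''Explicitly constructed'' is meant in the usual informal sense (a deterministic, non-probabilistic construction, such as Alon's algebraic triangle-free $(n,d,\lambda)$-graphs with $d=\Theta(n^{2/3})$, $\lambda=\Theta(n^{1/3})$, and their known generalizations without short odd cycles). *)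

(* Defs.v *)
From mathcomp Require Import all_boot.
Set Implicit Arguments.
Unset Strict Implicit.
Unset Printing Implicit Defensive.

(** * Finite simple graphs *)

Record sgraph (V : finType) := SGraph {
  adj : rel V;
  adj_sym : symmetric adj;
  adj_irr : irreflexive adj
}.

Definition degree (V : finType) (G : sgraph V) (x : V) : nat :=
  #|[set y | adj G x y]|.

Definition max_degree (V : finType) (G : sgraph V) : nat :=
  \max_(x : V) degree G x.

(* A cycle is given by the list of its vertices in cyclic order; the library's
   [ucycle] also accepts the empty list and, for an edge xy, the list
   [:: x; y], which the length condition rules out. *)
Definition is_cycle (V : finType) (G : sgraph V) (c : seq V) : Prop :=
  2 < size c /\ ucycle (adj G) c.

Definition is_tree (V : finType) (G : sgraph V) : Prop :=
  [/\ 0 < #|V|,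
      forall x y : V, connect (adj G) x y
    & forall c : seq V, ~ is_cycle G c].

(* H is a copy of a (not necessarily induced) subgraph of G. *)
Definition contains (V W : finType) (G : sgraph V) (H : sgraph W) : Prop :=
  exists f : W -> V,
    injective f /\ forall x y : W, adj H x y -> adj G (f x) (f y).

(* T(n, Delta)-universality; up to isomorphism every n-vertex tree has vertex
   set 'I_n. *)
Definition tree_universal (n Delta : nat) (V : finType) (G : sgraph V) : Prop :=
  forall T : sgraph 'I_n,
    is_tree T -> max_degree T <= Delta -> contains G T.

Definition no_short_odd_cycle (l : nat) (V : finType) (G : sgraph V) : Prop :=
  forall c : seq V, is_cycle G c -> odd (size c) -> ~ size c <= l.

(** * Explicit constructions

    Explicitness of a family of graphs is a property of a deterministic
    algorithm producing it.  The machine is the unit-cost random access machine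
    with addition and subtraction but no multiplication; since t steps lengthen
    the numbers it handles by at most t bits, it is polynomially equivalent to
    Turing machines. *)

Inductive instr :=
  | IConst of nat & nat       (* IConst a k : m[a] := k *)
  | IAdd of nat & nat & nat   (* IAdd a b c : m[a] := m[b] + m[c] *)
  | ISub of nat & nat & nat   (* ISub a b c : m[a] := m[b] - m[c], truncated *)
  | ILoad of nat & nat        (* ILoad a b  : m[a] := m[m[b]] *)
  | IStore of nat & nat       (* IStore a b : m[m[a]] := m[b] *)
  | IJz of nat & nat.         (* IJz a l    : if m[a] = 0 then go to l *)

Definition program := seq instr.

Definition memory := nat -> nat.

Definition upd (m : memory) (a v : nat) : memory :=
  fun b => if b == a then v else m b.

Record state := State { pc : nat; mem : memory }.

(* The machine has halted when the program counter is outside the program. *)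
Definition halted (p : program) (s : state) : bool := size p <= pc s.

Definition exec (i : instr) (s : state) : state :=
  let m := mem s in
  let next m' := State (pc s).+1 m' in
  match i with
  | IConst a k => next (upd m a k)
  | IAdd a b c => next (upd m a (m b + m c))
  | ISub a b c => next (upd m a (m b - m c))
  | ILoad a b => next (upd m a (m (m b)))
  | IStore a b => next (upd m (m a) (m b))
  | IJz a l => if m a == 0 then State l m else next m
  end.

Definition step (p : program) (s : state) : state :=
  if onth p (pc s) is Some i then exec i s else s.

Definition init (inputs : seq nat) : state := State 0 (nth 0 inputs).

(* On the given inputs, p halts within t steps with output v in cell 0. *)
Definition computes_in (p : program) (inputs : seq nat) (t v : nat) : Prop :=
  let s := iter t (step p) (init inputs) in halted p s /\ mem s 0 = v.

(* One program, given n and two vertices i, j < n, decides adjacency of i and j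
   in the n-th graph in time polynomial in n; equivalently, the adjacency matrix
   of that graph can be written down in time polynomial in n. *)
Definition explicitly_constructed (G : forall n : nat, sgraph 'I_n) : Prop :=
  exists (p : program) (a k : nat), forall (n : nat) (i j : 'I_n),
    computes_in p [:: n; val i; val j] (a * n ^ k) (adj (G n) i j).

(* Main.v *)
Require Import Defs.
From mathcomp Require Import all_boot perm zify.
Set Implicit Arguments.
Unset Strict Implicit.
Unset Printing Implicit Defensive.

(** The graph is a blow-up of the cycle 0, 1, ..., M with M = 2r + 2.  A closed
    walk of odd length in this cycle winds around it, so it has length at least
    M + 1.  Classes 0 and M hold about half of the vertices each, class j with
    0 < j < M holds a small proportion that decreases geometrically in j, and a
    tree embeds as soon as it has a homomorphism to the cycle whose fibres have
    exactly the sizes of the classes.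

    Such a homomorphism is found in two steps.  Cutting the rooted tree at
    every L-th level leaves pieces of bounded size.  Exchanging the two colours
    of the bipartition in one piece after another moves the size of a colour
    class from one side of n/2 to the other by bounded steps, so that some
    initial segment of the pieces balances the colours; the sparse cuts where
    the colouring is no longer proper are repaired by letting the tree walk the
    long way round the cycle below them.  Then the fibres are enlarged one
    vertex at a time: inside a ball mapped to the edge {0, M}, folding the tree
    into the path 0, 1, ..., l puts the centre in class l and affects otherwise
    only smaller classes.  Doing this for l = M, M - 1, ..., 1 makes all fibres
    exact. *)

(** * Walks in an odd cycle *)

(** With truncated subtraction d is |a - b|; the value M stands for the edge {0, M} that closes the
    cycle. *)
Definition cadj (M a b : nat) : bool :=
  let d := (a - b) + (b - a) in (d == 1) || (d == M).

Lemma cadj_sym M : symmetric (cadj M).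
Proof. by move=> a b; rewrite /cadj addnC. Qed.

Lemma cadj_irr M : 0 < M -> irreflexive (cadj M).
Proof. by move=> M_gt0 a; rewrite /cadj subnn /= eq_sym eqn0Ngt M_gt0. Qed.

(** Here a and b count the steps forward and backward along the cycle. *)
Lemma walk_winding (V : finType) (G : sgraph V) (M : nat) (c : V -> nat) :
    (forall x, c x <= M) -> (forall x y, adj G x y -> cadj M (c x) (c y)) ->
  forall x p, path (adj G) x p ->
  exists a b, a + b = size p /\ c x + a = c (last x p) + b %[mod M.+1].
Proof.
move=> c_le c_hom x p; elim: p x => [|y p IH] x /=; first by exists 0, 0.
case/andP=> xy /IH [a [b [ab_p eq_ab]]].
have eq_ab1 : (c y + a).+1 = (c (last y p) + b).+1 %[mod M.+1].
  by rewrite -addn1 -modnDml eq_ab modnDml addn1.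
have := c_hom _ _ xy; have := c_le x; have := c_le y.
rewrite /cadj => ley lex; have [ltxy|leyx] := ltnP (c x) (c y) => /orP[/eqP d1|/eqP dM].
- exists a.+1, b; split; first by rewrite addSn ab_p.
  by rewrite addnS -addSn (_ : (c x).+1 = c y) //; lia.
- exists a, b.+1; split; first by rewrite addnS ab_p.
  have -> : c x = 0 by lia.
  rewrite addnS -eq_ab1 (_ : c y = M); last by lia.
  by rewrite -addSn modnDl.
- exists a, b.+1; split; first by rewrite addnS ab_p.
  by rewrite addnS -eq_ab1 (_ : c x = (c y).+1) //; lia.
- exists a.+1, b; split; first by rewrite addSn ab_p.
  rewrite -eq_ab (_ : c x = M); last by lia.
  by rewrite (_ : c y = 0) ?addnS -?addSn ?modnDl //; lia.
Qed.

(** For a closed walk a and b agree modulo M + 1. At length at most M both are below M + 1, so a = b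
    and the length is even. *)
Lemma no_short_odd_closed_walk (V : finType) (G : sgraph V) (M : nat)
    (c : V -> nat) :
    (forall x, c x <= M) -> (forall x y, adj G x y -> cadj M (c x) (c y)) ->
  no_short_odd_cycle M G.
Proof.
move=> c_le c_hom [|x p] [] //= _ /andP[xp _] odd_p le_p.
have [a [b [ab_p]]] := walk_winding c_le c_hom xp.
rewrite last_rcons => /eqP; rewrite eqn_modDl size_rcons in ab_p * => /eqP ab.
move: ab; rewrite !modn_small; lia.
Qed.

(** * Consecutive blocks *)

(* The 1-based position x in a row of blocks of v * q cells, v running over vs;
   positions beyond the last block get the label size vs. *)
Fixpoint label (q : nat) (vs : seq nat) (x : nat) : nat :=
  if vs is v :: vs' then (0 < x - v * q) + label q vs' (x - v * q) else 0.

Lemma label0 q vs : label q vs 0 = 0.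
Proof. by elim: vs => //= v vs IH; rewrite sub0n IH. Qed.

Lemma label_le q vs x : label q vs x <= size vs.
Proof.
elim: vs x => //= v vs IH x; have := IH (x - v * q); case: (0 < _); lia.
Qed.

Lemma count_label q vs n j : sumn vs * q <= n ->
  count (fun i => label q vs i.+1 == j) (iota 0 n) =
  if j < size vs then nth 0 vs j * q
  else if j == size vs then n - sumn vs * q else 0.
Proof.
elim: vs n j => [|v vs IH] n j /= le_n.
  rewrite subn0; case: j => [|j] /=; first by rewrite count_predT size_iota.
  by rewrite count_pred0.
rewrite -[n in iota _ n](@subnKC (v * q)); last by nia.
rewrite iotaD count_cat add0n.
have -> : iota (v * q) (n - v * q) = map (addn (v * q)) (iota 0 (n - v * q)).
  by rewrite -iotaDl addn0.
rewrite count_map.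
have -> : count (fun i => label q (v :: vs) i.+1 == j) (iota 0 (v * q))
          = (j == 0) * (v * q).
  rewrite (@eq_in_count _ _ (fun _ => j == 0)).
    by case: eqP => _; rewrite ?count_predT ?count_pred0 ?size_iota ?mul1n.
  move=> i; rewrite mem_iota add0n /= => lt_i.
  by rewrite (_ : i.+1 - v * q = 0) ?label0 1?eq_sym //; lia.
rewrite (@eq_count _ _ (fun i => (label q vs i.+1).+1 == j)); last first.
  by move=> i /=; rewrite (_ : _ - v * q = i.+1) //; lia.
case: j => [|j] /=; first by rewrite mul1n count_pred0 addn0.
rewrite mul0n add0n (@eq_count _ _ (fun i => label q vs i.+1 == j)); last first.
  by move=> i; rewrite eqSS.
rewrite mulnDl in le_n *; rewrite IH; last by lia.
by rewrite subnDA ltnS eqSS.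
Qed.

Lemma perm_of_counts n (f g : 'I_n -> nat) :
    (forall j, #|[set i | f i == j]| = #|[set i | g i == j]|) ->
  exists s : 'I_n -> 'I_n, injective s /\ forall i, f i = g (s i).
Proof.
move=> eq_fg.
have cnt (h : 'I_n -> nat) j :
    count_mem j [tuple h i | i < n] = #|[set i | h i == j]|.
  rewrite cardsE cardE size_filter count_map.
  by rewrite -enumT; apply: eq_count.
have /tuple_permP [s eq_s] :
    perm_eq [tuple f i | i < n] [tuple g i | i < n].
  apply/allP => j _ /=; rewrite !cnt; exact/eqP.
exists s; split=> [|i]; first exact: perm_inj.
have eq_t : [tuple f i | i < n] = [tuple tnth [tuple g j | j < n] (s i) | i < n].
  exact/val_inj.
by have /(congr1 (fun t => tnth t i)) := eq_t; rewrite !tnth_mktuple.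
Qed.

(** * A program deciding adjacency *)

Lemma iter_step_halted p s t : halted p s -> iter t (step p) s = s.
Proof.
move=> h; elim: t => //= t ->; rewrite /step.
by rewrite onth_default.
Qed.

Definition straight (i : instr) : bool := if i is IJz _ _ then false else true.

Definition eff (m : memory) (i : instr) : memory :=
  Defs.mem (exec i (State 0 m)).

Lemma onth_cat_size (T : Type) (s1 s2 : seq T) x :
  onth (s1 ++ x :: s2) (size s1) = Some x.
Proof. by elim: s1. Qed.

Lemma run_straight p1 c p2 m : all straight c ->
  iter (size c) (step (p1 ++ c ++ p2)) (State (size p1) m)
  = State (size p1 + size c) (foldl eff m c).
Proof.
elim: c p1 m => [|i c IH] p1 m /=; first by rewrite addn0.
case/andP=> si sc; rewrite -iterS iterSr /step onth_cat_size.
have -> : exec i (State (size p1) m) = State (size (rcons p1 i)) (eff m i).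
  by rewrite size_rcons; case: i si.
rewrite -cat_rcons -/(step _).
by rewrite IH // size_rcons addSnnS.
Qed.

(* Cell 0 holds n + 1 minus the multiple of E subtracted so far, so that it
   vanishes exactly when no further E fits into n; the quotient is in cell 4.
   Cell 7 is never written, which makes [IJz 7 3] an unconditional jump. *)
Definition div_loop (E : nat) : program :=
  [:: IConst 3 E; IConst 6 1; IAdd 0 0 6;
      ISub 0 0 3; IJz 0 7; IAdd 4 4 6; IJz 7 3].

Lemma div_loop_body E p2 k m : 0 < E -> m 3 = E -> m 6 = 1 -> m 7 = 0 ->
    m 0 = k.+1 ->
  exists t m', [/\ iter t (step (div_loop E ++ p2)) (State 3 m) = State 7 m',
     t <= 4 * k + 2, m' 4 = m 4 + k %/ E
   & forall a, a != 0 -> a != 4 -> m' a = m a].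
Proof.
move=> E_gt0; have [N ltN] := ubnP k; elim: N k ltN m => // N IH k ltN m m3 m6 m7 m0.
have [ltkE|leEk] := ltnP k E.
  exists 2, (upd m 0 0); split=> //.
  - have e : m 0 - m 3 = 0 by lia.
    by rewrite /= /step /= e /= /step /= /upd /=.
  - lia.
  - by rewrite /upd /= divn_small ?addn0.
  - by move=> a /negPf a0 _; rewrite /upd a0.
pose m1 := upd (upd m 0 (k.+1 - E)) 4 (m 4 + 1).
case: (IH (k - E) _ m1) => //; first by lia.
  by rewrite /m1 /upd /=; lia.
move=> t [m' [run_t le_t m'4 fr]].
exists (t + 4), m'; split.
- rewrite iterD -run_t; congr iter.
  have e : m 0 - m 3 = (k - E).+1 by lia.
  rewrite /= /step /= e /= /step /= /upd /= /step /= /upd /= m7 m6 /=.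
  by rewrite /m1 /upd (_ : k.+1 - E = (k - E).+1) //; lia.
- nia.
- rewrite m'4 /m1 /upd /= -addnA; congr addn.
  by rewrite -[k in RHS](subnK leEk) divnDr ?dvdnn // divnn E_gt0 addnC.
- by move=> a a0 a4; rewrite fr // /m1 /upd (negPf a0) (negPf a4).
Qed.

Lemma run_div_loop E p2 n i j : 0 < E ->
  exists t m, [/\ iter t (step (div_loop E ++ p2)) (init [:: n; i; j]) = State 7 m,
     t <= 4 * n + 5, m 4 = n %/ E
   & [/\ m 1 = i, m 2 = j, m 6 = 1, m 7 = 0 & m 9 = 0]].
Proof.
move=> E_gt0.
pose m0 := foldl eff (nth 0 [:: n; i; j]) (take 3 (div_loop E)).
case: (@div_loop_body E p2 n m0 E_gt0) => //=; first by rewrite /m0 /= /eff /upd /= addn1.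
move=> t [m [run_t le_t m4 fr]]; exists (t + 3), m; split.
- by rewrite iterD -run_t.
- lia.
- by rewrite m4.
- by split; rewrite fr.
Qed.

(* Cell 8 holds the position, cell 9 the label; q is in cell 4 and 1 in cell 6. *)
Definition label_block (v : nat) : program :=
  nseq v (ISub 8 8 4) ++ [:: ISub 5 6 8; ISub 5 6 5; IAdd 9 9 5].

(** The recursion of [label] does not stop when the position reaches 0, so it unrolls into code
    without jumps. *)
Definition label_code (vs : seq nat) : program := flatten (map label_block vs).

Lemma straight_label_code vs : all straight (label_code vs).
Proof.
elim: vs => //= v vs IH; rewrite /label_code /= !all_cat /= all_nseq orbT.
exact: IH.
Qed.

(** In truncated subtraction 1 - (1 - x) is the truth value of 0 < x. *)
Lemma eff_label_block v m :
  let m' := foldl eff m (label_block v) in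
  [/\ m' 8 = m 8 - v * m 4,
      m 6 = 1 -> m' 9 = m 9 + (0 < m' 8)
    & forall a, a \notin [:: 5; 8; 9] -> m' a = m a].
Proof.
rewrite /label_block foldl_cat /=.
set m1 := foldl _ _ _.
have [m18 fr] : m1 8 = m 8 - v * m 4 /\ forall a, a != 8 -> m1 a = m a.
  rewrite /m1; elim: v m {m1} => [|v IH] m /=; first by rewrite subn0.
  case: (IH (eff m (ISub 8 8 4))) => -> fr; split.
    by rewrite /eff /= /upd /= -subnDA mulSn.
  by move=> a a8; rewrite fr // /eff /= /upd (negPf a8).
rewrite /eff /= /upd /=; split=> //.
  move=> m6; rewrite (fr 9) // (fr 6) // m6 m18; lia.
by move=> a; rewrite !inE !negb_or => /and3P[/negPf-> a8 /negPf->]; apply: fr.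
Qed.

Lemma eff_label_code vs m : m 6 = 1 ->
  let m' := foldl eff m (label_code vs) in
  m' 9 = m 9 + label (m 4) vs (m 8)
  /\ forall a, a \notin [:: 5; 8; 9] -> m' a = m a.
Proof.
elim: vs m => [|v vs IH] m m6; first by rewrite /= addn0.
rewrite /label_code /= foldl_cat -/(label_code vs).
have [m8 m9 fr] := eff_label_block v m.
move: m8 m9 fr; set m1 := foldl _ _ _ => m8 m9 fr.
case: (IH m1); first by rewrite fr.
move=> -> fr'; split; first by rewrite m9 // (fr 4) // m8 addnA.
by move=> a a_in; rewrite fr' // fr.
Qed.

(** Cell 10 saves the first label. The truncated 1 - |d - 1| and 1 - |d - M| are the two tests of
    [cadj]; for M > 1 at most one succeeds, so their sum is the disjunction. *)
Definition adj_code (M : nat) (vs : seq nat) : program :=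
  IAdd 8 1 6 :: label_code vs
  ++ [:: IAdd 10 9 7; IConst 9 0; IAdd 8 2 6] ++ label_code vs
  ++ [:: ISub 1 9 10; ISub 2 10 9; IAdd 1 1 2;
         ISub 2 1 6; ISub 3 6 1; IAdd 2 2 3; ISub 0 6 2;
         IConst 4 M; ISub 2 1 4; ISub 3 4 1; IAdd 2 2 3; ISub 2 6 2;
         IAdd 0 0 2].

Lemma straight_adj_code M vs : all straight (adj_code M vs).
Proof. by rewrite /= !all_cat /= !all_cat /= straight_label_code. Qed.

Lemma eff_adj_code M vs q i j m : 1 < M ->
    m 1 = i -> m 2 = j -> m 4 = q -> m 6 = 1 -> m 7 = 0 -> m 9 = 0 ->
  foldl eff m (adj_code M vs) 0
  = cadj M (label q vs i.+1) (label q vs j.+1).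
Proof.
move=> M_gt1 m1 m2 m4 m6 m7 m9; rewrite /adj_code /= foldl_cat /= foldl_cat.
set ma := eff m _.
have [a9 fra] := @eff_label_code vs ma m6.
move: a9 fra; set mb := foldl _ ma _ => a9 fra.
have b9 : mb 9 = label q vs i.+1.
  by rewrite a9 /ma /eff /= /upd /= m9 m4 m1 m6 addn1.
set mc := eff _ (IAdd 8 2 6).
have c6 : mc 6 = 1 by rewrite /mc /eff /= /upd /= fra // /ma /eff /= /upd /= m6.
have [d9 frd] := @eff_label_code vs mc c6.
move: d9 frd; set md := foldl _ mc _ => d9 frd.
have {}d9 : md 9 = label q vs j.+1.
  by rewrite d9 /mc /eff /= /upd /= !fra // /ma /eff /= /upd /= m2 m4 m6 addn1.
have d10 : md 10 = label q vs i.+1.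
  by rewrite frd // /mc /eff /= /upd /= b9 fra // /ma /eff /= /upd /= m7 addn0.
have d6 : md 6 = 1 by rewrite frd.
rewrite /eff /= /upd /= d9 d10 d6 /cadj.
move: (label _ _ _) (label _ _ _) => a b; rewrite [a - b + _]addnC.
move: (b - a + _) => d; lia.
Qed.

Lemma adj_computable E M vs (G : forall n, sgraph 'I_n) : 0 < E -> 1 < M ->
    (forall n (i j : 'I_n), adj (G n) i j
       = cadj M (label (n %/ E) vs i.+1) (label (n %/ E) vs j.+1)) ->
  explicitly_constructed G.
Proof.
move=> E_gt0 M_gt1 adjG.
(* As n >= 1, this linear bound covers the 4n + 5 steps of the division and the straight code after
   it. *)
exists (div_loop E ++ adj_code M vs), (9 + size (adj_code M vs)), 1 => n i j.
have n_gt0 : 0 < n by apply: leq_ltn_trans (ltn_ord i).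
have [t [m [run_t le_t m4 [m1 m2 m6 m7 m9]]]] :=
  run_div_loop (adj_code M vs) n i j E_gt0.
pose p := div_loop E ++ adj_code M vs.
have run_p : iter (size (adj_code M vs) + t) (step p) (init [:: n; val i; val j])
    = State (size p) (foldl eff m (adj_code M vs)).
  have := @run_straight (div_loop E) _ [::] m (straight_adj_code M vs).
  by rewrite cats0 iterD run_t /p size_cat.
rewrite /computes_in -/p; set T := (_ * _).
have -> : T = (T - (size (adj_code M vs) + t)) + (size (adj_code M vs) + t).
  by rewrite subnK // /T expn1; nia.
rewrite iterD run_p iter_step_halted; last exact: leqnn.
split; first exact: leqnn.
by rewrite adjG; exact: (eff_adj_code vs M_gt1 m1 m2 m4 m6 m7 m9).
Qed.

(** * Balls and rooted trees *)

Definition connected (V : finType) (G : sgraph V) : Prop :=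
  forall x y : V, connect (adj G) x y.

Fixpoint ball (V : finType) (G : sgraph V) (k : nat) (x : V) : {set V} :=
  if k is k'.+1 then
    ball G k' x :|: \bigcup_(z in ball G k' x) [set y | adj G z y]
  else [set x].

Section Ball.
Variables (V : finType) (G : sgraph V).
Implicit Types x y z : V.

Lemma ballS k x y z : y \in ball G k x -> adj G y z -> z \in ball G k.+1 x.
Proof.
move=> y_in yz; rewrite inE; apply/orP; right.
by apply/bigcupP; exists y; rewrite ?inE.
Qed.

Lemma ballSP k x y : y \in ball G k.+1 x ->
  y \in ball G k x \/ exists2 z, z \in ball G k x & adj G z y.
Proof.
rewrite inE => /orP[|/bigcupP[z z_in]]; first by left.
by rewrite inE; right; exists z.
Qed.

Lemma subset_ball k l x : k <= l -> ball G k x \subset ball G l x.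
Proof.
move=> /subnKC <-; elim: (l - k) => [|j IH]; first by rewrite addn0.
by rewrite addnS; apply: subset_trans IH _; apply: subsetUl.
Qed.

Lemma ball_trans k l x y z :
  y \in ball G k x -> z \in ball G l y -> z \in ball G (k + l) x.
Proof.
move=> y_in; elim: l z => [|l IH] z.
  by rewrite inE => /eqP->; rewrite addn0.
case/ballSP=> [/IH z_in|[w /IH w_in wz]]; rewrite addnS.
  by apply: subsetP z_in; apply: subset_ball.
exact: ballS wz.
Qed.

Lemma ball_sym k x y : y \in ball G k x -> x \in ball G k y.
Proof.
elim: k y => [|k IH] y; first by rewrite !inE eq_sym.
case/ballSP=> [/IH x_in|[z /IH x_in zy]].
  by apply: subsetP x_in; apply: subset_ball.
rewrite -add1n; apply: ball_trans x_in.
by apply: (@ballS 0 y y z); [rewrite inE | rewrite adj_sym].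
Qed.

Lemma card_ball Delta k x : max_degree G <= Delta ->
  #|ball G k x| <= Delta.+1 ^ k.
Proof.
move=> le_D; elim: k => [|k IH]; first by rewrite cards1.
rewrite (leq_trans (leq_card_setU _ _)) // expnS mulSn leq_add //.
apply: leq_trans (_ : #|ball G k x| * Delta <= _); last first.
  by rewrite mulnC leq_mul2l IH orbT.
rewrite -sum_nat_const; elim/big_rec2: _ => [|z n A _ le_n]; first by rewrite cards0.
rewrite (leq_trans (leq_card_setU _ _)) // leq_add //.
apply: leq_trans le_D; exact: (leq_bigmax z).
Qed.

Definition gdist x y : nat := find (fun k => y \in ball G k x) (iota 0 #|V|).

Lemma gdistE k x y : connected G -> (gdist x y <= k) = (y \in ball G k x).
Proof.
move=> conn.
have path_ball p : path (adj G) x p -> last x p \in ball G (size p) x.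
  elim/last_ind: p => [|p z IH]; first by rewrite inE.
  rewrite rcons_path last_rcons size_rcons => /andP[/IH xp pz].
  exact: ballS pz.
have in_ball : has (fun k => y \in ball G k x) (iota 0 #|V|).
  have /connectP [p xp ->] := conn x y.
  have [q xq uq _] := shortenP xp; apply/hasP; exists (size q); last exact: path_ball.
  rewrite mem_iota add0n /=.
  by have := max_card (mem (x :: q)); rewrite (card_uniqP uq).
have lt_V : gdist x y < #|V| by rewrite -[X in _ < X](size_iota 0) -has_find.
apply/idP/idP => [le_k|y_in].
  apply: (subsetP (subset_ball x le_k)).
  by have := nth_find 0 in_ball; rewrite nth_iota.
rewrite leqNgt; apply/negP => lt_k.
have := before_find 0 lt_k; rewrite nth_iota ?add0n ?y_in //.
exact: ltn_trans lt_V.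
Qed.

Lemma gdist_adj x y z : connected G -> adj G y z -> gdist x z <= (gdist x y).+1.
Proof.
by move=> conn yz; rewrite gdistE //; apply: ballS yz; rewrite -gdistE.
Qed.

Lemma gdist_pred x y k : connected G -> gdist x y = k.+1 ->
  exists2 z, adj G z y & gdist x z = k.
Proof.
move=> conn eq_k.
have: y \in ball G k.+1 x by rewrite -gdistE // eq_k.
case/ballSP=> [|[z]]; rewrite -gdistE //; first by rewrite eq_k ltnn.
move=> le_k zy; exists z => //; apply/eqP; rewrite eqn_leq le_k /=.
by rewrite -ltnS -eq_k gdist_adj.
Qed.

Lemma gdist_eq0 x y : connected G -> (gdist x y == 0) = (y == x).
Proof. by move=> conn; rewrite -leqn0 gdistE // inE. Qed.

End Ball.

(** Shortened and closed by xy, a path ending in y would be a cycle; it has at least three vertices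
    because the step from x to y is barred. *)
Lemma acyclic_bridge (V : finType) (G : sgraph V) x y p :
    (forall c, ~ is_cycle G c) -> adj G x y ->
    path (fun u v => adj G u v && ((u, v) != (x, y))) x p -> last x p <> y.
Proof.
move=> acyc xy xp; case/shortenP: xp => q xq uq _ eq_q.
apply: (acyc (x :: q)); split.
  case: q xq uq eq_q => [|z [|w q]] //=.
    by move=> _ _ eq_xy; rewrite -eq_xy adj_irr in xy.
  by rewrite andbT => /andP[_ ne] _ eq_zy; rewrite eq_zy eqxx in ne.
rewrite /ucycle uq andbT /= rcons_path eq_q adj_sym xy andbT.
by apply: sub_path xq => u v /andP[].
Qed.

(** Depth is the distance to a root, and the parent is a neighbour closer to it. Any edge not of the
    form {x, par x} could be removed with both ends still joined to the root, so it would lie on a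
    cycle. *)
Lemma rooted_tree (V : finType) (G : sgraph V) : is_tree G ->
  exists (par : V -> V) (dep : V -> nat),
  [/\ forall x y, adj G x y -> par x = y /\ 0 < dep x \/ par y = x /\ 0 < dep y,
      forall x, 0 < dep x -> adj G x (par x) /\ dep x = (dep (par x)).+1
    & forall x, dep x = 0 -> par x = x].
Proof.
case=> /card_gt0P[r _] conn acyc.
pose dep := gdist G r.
pose par x := if [pick z | adj G z x && ((dep z).+1 == dep x)] is Some z then z else x.
have parP x : 0 < dep x -> adj G x (par x) /\ dep x = (dep (par x)).+1.
  move=> x_gt0; rewrite /par; case: pickP => [z /andP[zx /eqP <-]|none].
    by rewrite adj_sym.
  case: (@gdist_pred _ G r x (dep x).-1 conn); first by rewrite prednK.
  move=> z zx dz; have := none z.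
  by rewrite zx /dep dz prednK ?eqxx.
exists par, dep; split=> // [x y xy|x x0]; last first.
  by rewrite /par; case: pickP => // z /andP[_]; rewrite x0.
wlog le_yx : x y xy / dep y <= dep x.
  move=> W; case: (leqP (dep y) (dep x)) => [|/ltnW] le; first exact: W.
  by rewrite adj_sym in xy; case: (W _ _ xy le); [right | left].
have [pxy|pxy] := eqVneq (par x) y.
  left; split=> //; rewrite lt0n; apply/eqP => x0; move: pxy; rewrite /par.
  case: pickP => [z /andP[_]|_ exy]; first by rewrite x0.
  by rewrite exy adj_irr in xy.
exfalso; pose e u v := adj G u v && ((u, v) != (x, y)) && ((u, v) != (y, x)).
have e_sym : symmetric e.
  by move=> u v; rewrite /e adj_sym !xpair_eqE; case: (u == x); case: (v == y);
     case: (u == y); case: (v == x); case: adj.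
(* The edge xy does not lie on any path towards the root. *)
have climb v : connect e v r.
  have [N] := ubnP (dep v); elim: N v => // N IH v ltN.
  have [v0|v_gt0] := posnP (dep v).
    have /eqP := v0; rewrite gdist_eq0 // => /eqP->; exact: connect0.
  have [vp dv] := parP v v_gt0.
  apply: connect_trans (IH (par v) _); last by lia.
  apply: connect1; rewrite /e vp /= !xpair_eqE.
  apply/andP; split; apply/negP => /andP[/eqP ev /eqP ep].
    by rewrite -ev ep eqxx in pxy.
  by move: le_yx; rewrite -ev -ep; lia.
have /connectP [p xp ly] : connect e x y.
  by apply: connect_trans (climb x) _; rewrite (sym_connect_sym e_sym).
apply: (@acyclic_bridge _ G x y p acyc xy) => //.
by apply: sub_path xp => u v /andP[].
Qed.

(** * Adjusting the fibres *)

Definition cycle_hom (V : finType) (G : sgraph V) (M : nat) (h : V -> nat) :=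
  (forall x, h x <= M) /\ forall x y, adj G x y -> cadj M (h x) (h y).

Definition odd_side (M a : nat) : bool := odd a || (a == M).

(* In class M we count all vertices on the side of M in the bipartition of the
   path obtained from the cycle by deleting the edge {M - 1, M}: this number is
   not affected by adjusting the classes j with 0 < j < M. *)
Definition filling (V : finType) (M : nat) (h : V -> nat) (j : nat) : nat :=
  if j == M then #|[set v | odd_side M (h v)]| else #|[set v | h v == j]|.

(** At distance l the fold would give 0, which is the value of h there by [dig_old]; so the fold
    fits the outside. *)
Definition dig (V : finType) (G : sgraph V) (l : nat) (c : V) (h : V -> nat) v :=
  if gdist G c v < l then l - gdist G c v else h v.

Section Dig.
Variables (V : finType) (G : sgraph V) (M l : nat) (c : V) (h : V -> nat).
Hypotheses (conn : connected G) (M_gt1 : 1 < M) (M_even : ~~ odd M).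
Hypotheses (l_gt0 : 0 < l) (l_le : l <= M) (h_hom : cycle_hom G M h).
Hypothesis h_free : forall v, gdist G c v <= l -> (h v == 0) || (h v == M).
Hypothesis h_c : h c = if odd l then M else 0.

(** In the ball only the classes 0 and M occur, so they alternate with the distance; the class of c
    is chosen such that 0 appears at distance l. *)
Lemma dig_old v : gdist G c v <= l ->
  h v = if odd (l + gdist G c v) then M else 0.
Proof.
have [k] := ubnP (gdist G c v); elim: k v => // k IH v lt_k le_l.
case dv : (gdist G c v) => [|d].
  have /eqP := dv; rewrite gdist_eq0 // => /eqP->; by rewrite addn0.
have [z zv dz] := gdist_pred conn dv.
have := h_hom.2 _ _ zv; have := h_free le_l.
rewrite (IH z) ?dz; try lia.
rewrite /cadj addnS /=; case: (odd _) => /=; lia.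
Qed.

Lemma dig_hom : cycle_hom G M (dig G l c h).
Proof.
split=> [x|x y xy]; first by rewrite /dig; case: ifP => _; [lia | exact: h_hom.1].
have dxy := gdist_adj c conn xy.
have dyx : gdist G c x <= (gdist G c y).+1.
  by apply: gdist_adj => //; rewrite adj_sym.
have := h_hom.2 _ _ xy; have := @dig_old x; have := @dig_old y.
rewrite /dig; case: ltnP => [ltx|lex]; case: ltnP => [lty|ley] //.
- move=> /(_ (ltnW lty)) -> /(_ (ltnW ltx)) ->; rewrite /cadj.
  have [e|ne] := eqVneq (gdist G c x) (gdist G c y); last by lia.
  by rewrite e; case: (odd _); lia.
- have ex : gdist G c x = l.-1 by lia.
  have ey : gdist G c y = l by lia.
  by move=> /(_ (_ : _ <= _)) -> ; rewrite ?ex ?ey ?addnn ?odd_double /cadj; lia.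
- have ex : gdist G c x = l by lia.
  have ey : gdist G c y = l.-1 by lia.
  by move=> _ /(_ (_ : _ <= _)) ->; rewrite ?ex ?ey ?addnn ?odd_double /cadj; lia.
Qed.

Lemma dig_center v : gdist G c v = 0 -> v = c.
Proof. by move/eqP; rewrite gdist_eq0 // => /eqP. Qed.

(** At distance d < l the new value l - d is odd exactly where h was M. Hence a vertex joins the
    side of M only by receiving M itself, which happens at the centre when l = M. For l < M the
    centre alone receives l, and no vertex of the ball had it. *)
Lemma filling_dig_eq : filling M (dig G l c h) l = (filling M h l).+1.
Proof.
have dcc : gdist G c c = 0 by apply/eqP; rewrite gdist_eq0.
rewrite /filling; case: eqP => [eqM|neM].
  rewrite [in RHS](_ : #|_|.+1 = #|c |: [set v | odd_side M (h v)]|).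
    apply: eq_card => v; rewrite !inE /dig /odd_side.
    have [ltv|lev] := ltnP; last first.
      have -> : v == c = false by apply/negP => /eqP ev; rewrite ev dcc in lev; lia.
      by [].
    rewrite (dig_old (ltnW ltv)) eqM.
    have [->|nvc] := eqVneq v c; first by rewrite dcc subn0 eqxx orbT.
    have : gdist G c v != 0 by apply: contra_neq nvc; apply: dig_center.
    move: ltv M_even; rewrite eqM; case: (odd (M + _)) (oddD M (gdist G c v)) => /=; lia.
  rewrite cardsU1 inE h_c eqM (negPf M_even) /odd_side /=.
  by rewrite (_ : 0 == M = false) //; lia.
rewrite [in RHS](_ : #|_|.+1 = #|c |: [set v | h v == l]|).
  apply: eq_card => v; rewrite !inE /dig.
  have [ltv|lev] := ltnP; last first.
    have -> : v == c = false by apply/negP => /eqP ev; rewrite ev dcc in lev; lia.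
    by [].
  rewrite (dig_old (ltnW ltv)).
  have [->|nvc] := eqVneq v c; first by rewrite dcc subn0 eqxx.
  have : gdist G c v != 0 by apply: contra_neq nvc; apply: dig_center.
  by case: (odd _) => /=; lia.
rewrite cardsU1 inE h_c; case: (odd l); last by case: eqP => //; lia.
by case: eqP => //; lia.
Qed.

Lemma filling_dig_gt j : l < j -> j <= M ->
  filling M (dig G l c h) j = filling M h j.
Proof.
move=> lt_j le_j; rewrite /filling; case: eqP => [eqM|neM].
  apply: eq_card => v; rewrite !inE /dig /odd_side.
  have [ltv|//] := ltnP; rewrite (dig_old (ltnW ltv)).
  have := oddB (ltnW ltv); rewrite oddD => ->.
  by case: (_ (+) _); rewrite /= ?eqxx ?orbT //; lia.
apply: eq_card => v; rewrite !inE /dig.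
have [ltv|//] := ltnP; rewrite (dig_old (ltnW ltv)).
by case: (odd _); lia.
Qed.

Lemma filling_dig_lt Delta j : max_degree G <= Delta -> 0 < j -> j < l ->
  filling M (dig G l c h) j <= filling M h j + Delta.+1 ^ M.+1.
Proof.
move=> le_D j_gt0 lt_j; rewrite /filling; case: eqP => [|_]; first by lia.
apply: (@leq_trans #|[set v | h v == j] :|: ball G M.+1 c|).
  apply/subset_leq_card/subsetP => v; rewrite !inE -!in_setU /dig.
  have [ltv _|_ ->] := ltnP; last by [].
  apply/orP; right.
  have : v \in ball G M.+1 c by rewrite -gdistE //; lia.
  by rewrite inE.
by rewrite (leq_trans (leq_card_setU _ _)) // leq_add2l card_ball.
Qed.

Lemma filling_dig_ge j : 0 < j -> j < l ->
  filling M h j <= filling M (dig G l c h) j.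
Proof.
move=> j_gt0 lt_j; rewrite /filling; case: eqP => [|_]; first by lia.
apply/subset_leq_card/subsetP => v; rewrite !inE /dig.
have [ltv|//] := ltnP; rewrite (dig_old (ltnW ltv)).
by case: (odd _); lia.
Qed.

End Dig.

Lemma sum_filling (V : finType) (M : nat) (h : V -> nat) (P : pred nat) :
  #|[set v | P (h v) && (0 < h v < M)]| = \sum_(1 <= j < M | P j) filling M h j.
Proof.
rewrite -sum1_card.
rewrite (eq_bigr (fun v => \sum_(1 <= j < M | P j) (h v == j : nat))); last first.
  move=> v; rewrite inE => /andP[Pv h_in].
  rewrite big_mkcond (bigD1_seq (h v)) ?iota_uniq ?mem_index_iota //= Pv eqxx.
  by rewrite big1 // => j; rewrite eq_sym => /negPf->; case: ifP.
rewrite exchange_big /= [LHS]big_nat_cond [RHS]big_nat_cond.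
apply: eq_bigr => j /andP[j_in Pj].
rewrite /filling; case: eqP => [|_]; first by lia.
rewrite -sum1_card [RHS]big_mkcond /= big_mkcond /=; apply: eq_bigr => v _.
rewrite !inE; case: (h v =P j) => [->|_]; last by case: ifP.
by rewrite Pj j_in.
Qed.

(** The balls around the vertices of middle classes do not cover V. The radius M + 1 instead of M
    leaves room to move the centre to a neighbour. *)
Lemma exists_free_center (V : finType) (G : sgraph V) M Delta h :
    connected G -> max_degree G <= Delta -> (forall v, h v <= M) ->
    (\sum_(1 <= j < M) filling M h j) * Delta.+1 ^ M.+1 < #|V| ->
  exists c, forall v, gdist G c v <= M.+1 -> (h v == 0) || (h v == M).
Proof.
move=> conn le_D h_le; rewrite -sum_filling; set U := [set v | _] => lt_V.
have : ~~ ([set: V] \subset \bigcup_(u in U) ball G M.+1 u).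
  apply: contraTN lt_V => /subset_leq_card; rewrite cardsT -leqNgt => le_V.
  apply: leq_trans le_V _; rewrite -sum_nat_const.
  elim/big_rec2: _ => [|u n A _ le_n]; first by rewrite cards0.
  by rewrite (leq_trans (leq_card_setU _ _)) // leq_add // card_ball.
case/subsetPn => c _ c_free; exists c => v; rewrite gdistE // => v_in.
apply: contraR c_free; rewrite negb_or => v_U.
by apply/bigcupP; exists v; [rewrite /U inE; have := h_le v; lia | exact: ball_sym].
Qed.

(** If the free centre lies in the wrong one of the classes 0 and M, a neighbour lies in the right
    one, and its ball of radius l is still free. *)
Lemma exists_dig (V : finType) (G : sgraph V) M Delta h l :
    connected G -> max_degree G <= Delta -> 1 < #|V| ->
    1 < M -> ~~ odd M -> 0 < l <= M -> cycle_hom G M h ->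
    (\sum_(1 <= j < M) filling M h j) * Delta.+1 ^ M.+1 < #|V| ->
  exists h', [/\ cycle_hom G M h', filling M h' l = (filling M h l).+1,
    forall j, l < j <= M -> filling M h' j = filling M h j
  & forall j, 0 < j < l ->
      filling M h j <= filling M h' j <= filling M h j + Delta.+1 ^ M.+1].
Proof.
move=> conn le_D V_gt1 M_gt1 M_even /andP[l_gt0 l_le] h_hom lt_V.
have [c0 c0_free] := exists_free_center conn le_D h_hom.1 lt_V.
suff [c c_free h_c] : exists2 c, forall v, gdist G c v <= l -> (h v == 0) || (h v == M)
    & h c = if odd l then M else 0.
  exists (dig G l c h); split; first exact: dig_hom.
  - exact: filling_dig_eq.
  - by move=> j /andP[lt_j le_j]; apply: filling_dig_gt.
  - by move=> j /andP[j_gt0 lt_j]; rewrite filling_dig_ge ?filling_dig_lt.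
have dc0 : gdist G c0 c0 = 0 by apply/eqP; rewrite gdist_eq0.
have [h_c0|n_c0] := eqVneq (h c0) (if odd l then M else 0).
  by exists c0 => // v le_v; apply: c0_free; apply: leq_trans le_v _; apply: leqW.
have [c c0c] : exists c, adj G c0 c.
  have [x [y [_ _ nxy]]] := card_gt1P V_gt1.
  have [y' ny'] : exists y', y' != c0.
    have [ex|] := eqVneq x c0; last by exists x.
    by exists y; rewrite -ex eq_sym.
  have /connectP [[|z p] /=] := conn c0 y'; first by move=> _ e; rewrite e eqxx in ny'.
  by case/andP; exists z.
exists c => [v le_v|].
  apply: c0_free; rewrite gdistE //.
  have : v \in ball G (1 + l) c0.
    apply: (@ball_trans _ _ 1 l c0 c); last by rewrite -gdistE.
    by apply: (@ballS _ _ 0 _ c0); rewrite ?inE.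
  by apply: subsetP; apply: subset_ball; lia.
have := gdist_adj c0 conn c0c; rewrite dc0 => le1.
have := h_hom.2 _ _ c0c; have := c0_free c0; rewrite dc0 => /(_ isT).
have := c0_free c (leq_trans le1 (ltnS 0 M)).
by move: n_c0; rewrite /cadj; case: (odd l); lia.
Qed.

(** The hypothesis on i reserves room in class i for C vertices per dig still due above it. A dig
    adds at most C to a smaller class and lowers the deficit above it, so the reserve persists.
    Fillings of at most g always leave a free centre. *)
Lemma fill_exactly (V : finType) (G : sgraph V) M Delta (g : nat -> nat) h :
    connected G -> max_degree G <= Delta -> 1 < #|V| -> 1 < M -> ~~ odd M ->
    (\sum_(1 <= j < M) g j) * Delta.+1 ^ M.+1 < #|V| -> cycle_hom G M h ->
    (forall i, 0 < i <= M -> filling M h i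
       + Delta.+1 ^ M.+1 * (\sum_(i.+1 <= j < M.+1) (g j - filling M h j)) <= g i) ->
  exists2 h', cycle_hom G M h' & forall j, 0 < j <= M -> filling M h' j = g j.
Proof.
move=> conn le_D V_gt1 M_gt1 M_even; set C := Delta.+1 ^ M.+1 => lt_V.
have [N] := ubnP (\sum_(1 <= j < M.+1) (g j - filling M h j)).
elim: N h => // N IH h lt_N h_hom inv.
(* Dig at the largest deficient level: this pays for what it adds below. *)
have le_g i : 0 < i <= M -> filling M h i <= g i.
  by move/inv; apply: leq_trans; apply: leq_addr.
have [/existsP ex|none] := boolP [exists j : 'I_M.+1, (0 < j) && (filling M h j < g j)];
  last first.
  exists h => // j j_in; apply/eqP; rewrite eqn_leq le_g //= leqNgt.
  have lt_j : j < M.+1 by lia.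
  by move/existsPn: none => /(_ (Ordinal lt_j)) /=; rewrite negb_and; lia.
have [l0 /andP[l0_gt0 l0_lt]] := ex.
have [l /andP[l_gt0 l_lt] l_max] :=
  @arg_maxnP _ l0 (fun j : 'I_M.+1 => (0 < j) && (filling M h j < g j)) val
    (introT andP (conj l0_gt0 l0_lt)).
have le_l : l <= M by rewrite -ltnS.
have full j : l < j <= M -> filling M h j = g j.
  move=> j_in; apply/eqP; rewrite eqn_leq le_g /=; last by lia.
  have lt_j : j < M.+1 by lia.
  rewrite leqNgt; apply/negP => def_j.
  by have := l_max (Ordinal lt_j) => /=; rewrite def_j; lia.
case: (@exists_dig V G M Delta h l) => //; first by rewrite l_gt0.
  apply: leq_ltn_trans lt_V; rewrite leq_mul2r; apply/orP; right.
  by rewrite !big_nat; apply: leq_sum => j j_in; apply: le_g; lia.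
move=> h' [h'_hom h'_l h'_gt h'_lt].
have deficit_lt i : i < l ->
    \sum_(i.+1 <= j < M.+1) (g j - filling M h' j)
    < \sum_(i.+1 <= j < M.+1) (g j - filling M h j).
  move=> lt_il.
  have l_in : val l \in index_iota i.+1 M.+1 by rewrite mem_index_iota lt_il ltnS.
  rewrite !(bigD1_seq (val l)) ?iota_uniq //= h'_l -addSn leq_add //; first by lia.
  rewrite big_seq_cond [leqRHS]big_seq_cond; apply: leq_sum => j.
  rewrite mem_index_iota => /andP[j_in ne_j].
  have [lt_jl|le_lj] := ltnP j l; last by rewrite h'_gt //; lia.
  by have := h'_lt j; lia.
apply: (IH h') => // [|i i_in]; first by have := deficit_lt 0 l_gt0; lia.
have [le_li|lt_il] := leqP l i.
  rewrite big_nat big1 => [|j j_in]; last by rewrite h'_gt ?full ?subnn //; lia.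
  rewrite muln0 addn0; have [->|ne] := eqVneq i (val l); first by rewrite h'_l.
  have lt_li : l < i <= M by rewrite ltn_neqAle eq_sym ne le_li; case/andP: i_in.
  by rewrite h'_gt // le_g.
apply: leq_trans (inv i i_in).
have /andP[_ le_f] : filling M h i <= filling M h' i <= filling M h i + C.
  by apply: h'_lt; case/andP: i_in => ->.
apply: leq_trans (leq_add le_f (leqnn _)) _.
by rewrite -addnA leq_add2l -mulnS leq_mul2l deficit_lt ?orbT.
Qed.

(** * A balanced homomorphism *)

Lemma discrete_ivt (F : nat -> nat) N a R :
    F 0 <= a -> a <= F N -> (forall t, F t.+1 <= F t + R) ->
  exists2 t, F t <= a & a <= F t + R.
Proof.
move=> F0 + step; elim: N => [|N IH] leF; first by exists 0; lia.
have [/IH //|lt_a] := leqP a (F N).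
by exists N; [apply: ltnW | apply: leq_trans leF _].
Qed.

(** Averaging: each vertex meets the condition for at most M of the L offsets, since distinct
    offsets give distinct residues. *)
Lemma exists_sparse_offset (V : finType) (dep : V -> nat) L M : 0 < M -> M <= L ->
  exists o, #|[set v | (dep v + o) %% L < M]| * L <= #|V| * M.
Proof.
move=> M_gt0 leML; have L_gt0 : 0 < L by lia.
pose f (o : 'I_L) := #|[set v | (dep v + o) %% L < M]|.
have sum_f : \sum_(o < L) f o <= #|V| * M.
  rewrite /f (eq_bigr (fun o : 'I_L => \sum_v ((dep v + o) %% L < M : nat))); last first.
    move=> o _; rewrite -sum1_card big_mkcond /=; apply: eq_bigr => v _.
    by rewrite inE; case: (_ < M).
  rewrite exchange_big -sum_nat_const /=; apply: leq_sum => v _.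
  rewrite -[leqLHS]big_mkcond /= sum1_card -[leqRHS]card_ord.
  case: M M_gt0 leML {f} => // M _ leML.
  apply: (@leq_card_in _ _ (fun o : 'I_L => inord ((dep v + o) %% L) : 'I_M.+1)).
  move=> o1 o2; rewrite !unfold_in /= => lt1 lt2 /(congr1 val); rewrite /= !inordK // => /eqP.
  by rewrite eqn_modDl !modn_small // => /eqP /val_inj.
pose i0 : 'I_L := Ordinal L_gt0.
exists [arg min_(o < i0) f o]; case: arg_minnP => // o _ o_min.
apply: leq_trans sum_f; rewrite mulnC -[X in X * _]card_ord -sum_nat_const.
by apply: leq_sum => i _; apply: o_min.
Qed.

Section Cut.
Variables (n : nat) (G : sgraph 'I_n) (par : 'I_n -> 'I_n) (dep : 'I_n -> nat).
Hypothesis edge_par : forall x y, adj G x y ->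
  par x = y /\ 0 < dep x \/ par y = x /\ 0 < dep y.
Hypothesis parP : forall x, 0 < dep x -> adj G x (par x) /\ dep x = (dep (par x)).+1.
Hypothesis par_root : forall x, dep x = 0 -> par x = x.
Variables (M L o t : nat) (b : bool).
Hypotheses (M_gt1 : 1 < M) (M_even : ~~ odd M) (ltML : M < L).

Definition level v := (dep v + o) %% L.
Definition piece v := iter (level v) par v.
(* The colour of v, exchanged in the pieces whose root has index below t; true
   is the side of class M. *)
Definition side v := odd (dep v) (+) b (+) (piece v < t).
Definition cut v := (piece v < t) != (piece (par v) < t).
(* Below a cut that joins two vertices of the same colour the tree descends from
   class M - 1 (on the side of M) or M (on the side of 0) to class 0. *)
Definition depth_in_path v :=
  if cut (piece v) then M - side (piece v) - level v else 0.
Definition fold v :=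
  if 0 < depth_in_path v then depth_in_path v else if side v then M else 0.

Lemma level_par v : 0 < dep v -> 0 < level v -> level v = (level (par v)).+1.
Proof.
move=> /parP[_ dv]; rewrite /level dv addSn modnS; case: ifP => //.
Qed.

Lemma level_par0 v : 0 < dep v -> level v = 0 -> level (par v) = L.-1.
Proof.
move=> /parP[_ dv]; rewrite /level dv addSn modnS; case: ifP => // L_dv _.
have L_gt0 : 0 < L by lia.
move: L_dv; rewrite {1}(divn_eq (dep (par v) + o) L) -addnS dvdn_addr ?dvdn_mull //.
have := ltn_pmod (dep (par v) + o) L_gt0.
by move: (_ %% L) => r lt_r /dvdn_leq; lia.
Qed.

Lemma piece_par v : 0 < dep v -> 0 < level v -> piece (par v) = piece v.
Proof. by move=> v_gt0 lv; rewrite /piece (level_par v_gt0 lv) iterSr. Qed.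

Lemma piece0 v : level v = 0 -> piece v = v.
Proof. by rewrite /piece => ->. Qed.

Lemma piece_root v : dep v = 0 -> piece v = v.
Proof. by move=> v0; rewrite /piece; elim: (level v) => //= k ->; apply: par_root. Qed.

(** Inside a piece the colours alternate. The cut rules out the piece of the tree root, the only one
    in which [level v] need not be the distance to [piece v]. *)
Lemma side_piece v : cut (piece v) -> side v = side (piece v) (+) odd (level v).
Proof.
have [k] := ubnP (level v); elim: k v => // k IH v ltk cut_v.
have [lv|lv] := posnP (level v); first by rewrite lv piece0 // addbF.
have [v0|v_gt0] := posnP (dep v).
  by move: cut_v; rewrite piece_root // /cut par_root // eqxx.
have [_ dv] := parP v_gt0; have lp := level_par v_gt0 lv.
have sv : side v = ~~ side (par v).
  by rewrite /side piece_par // dv oddS -!addNb.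
rewrite sv (IH (par v)) ?piece_par //; last by lia.
by rewrite lp oddS -addbN.
Qed.

Lemma odd_depth_in_path v : 0 < depth_in_path v -> odd (depth_in_path v) = side v.
Proof.
rewrite /depth_in_path; case: ifP => // cut_v v_gt0; rewrite (side_piece cut_v).
rewrite oddB; last by lia.
rewrite oddB; last by case: (side _); lia.
by rewrite (negPf M_even) oddb addFb.
Qed.

(** At the top of a piece the parent has level L - 1 >= M, beyond any descent, so its class is 0 or
    M; if the colours agree, the descent starts next to that class. Lower down a descent drops by
    one per level, and off it the colours alternate. *)
Lemma fold_par v : 0 < dep v -> cadj M (fold v) (fold (par v)).
Proof.
move=> v_gt0; have [_ dv] := parP v_gt0.
have [lv|lv] := posnP (level v).
  have lp := level_par0 v_gt0 lv.
  have p0 : depth_in_path (par v) = 0.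
    by rewrite /depth_in_path lp; case: ifP => //; lia.
  rewrite /fold p0 /=; rewrite /depth_in_path lv piece0 // subn0.
  have eq_s : cut v = (side v == side (par v)).
    rewrite /cut /side dv oddS.
    by case: (odd _); case: b; case: (piece v < t); case: (piece _ < t).
  rewrite eq_s; have [<-|] := eqVneq.
    by rewrite (_ : 0 < _) /cadj; case: (side v); lia.
  by case: (side v); case: (side (par v)) => //= _; rewrite /cadj; lia.
have lp := level_par v_gt0 lv.
have sv : side v = ~~ side (par v).
  by rewrite /side piece_par // dv oddS -!addNb.
have := @odd_depth_in_path v; have := @odd_depth_in_path (par v).
have e : depth_in_path v = (depth_in_path (par v)).-1.
  by rewrite /depth_in_path piece_par //; case: ifP; lia.
rewrite /fold e sv; case: (depth_in_path (par v)) => [|[|d]] /=.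
- by case: side; rewrite /= /cadj; lia.
- by move=> /(_ isT) <- _ /=; rewrite /cadj; lia.
- by rewrite /cadj; lia.
Qed.

Lemma fold_hom : cycle_hom G M fold.
Proof.
split=> [v|x y xy].
  rewrite /fold /depth_in_path; case: (cut _); last by case: (side v).
  by case: ifP => _; [lia | case: (side v)].
case: (edge_par xy) => [[<- x_gt0]|[<- y_gt0]]; first exact: fold_par.
by rewrite cadj_sym fold_par.
Qed.

Lemma filling_fold_lt j : 0 < j < M ->
  filling M fold j <= #|[set v | level v < M]|.
Proof.
move=> j_in; rewrite /filling; case: eqP => [|_]; first by lia.
apply/subset_leq_card/subsetP => v; rewrite !inE /fold /depth_in_path.
by case: (cut _); (case: ifP => [|_]; last by case: (side v); lia); lia.
Qed.

(** By parity a vertex changes its side only by starting a descent in class M, at level 0. *)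
Lemma filling_fold_M : #|[set v | side v]| <= filling M fold M
  <= #|[set v | side v]| + #|[set v | level v < M]|.
Proof.
rewrite /filling eqxx; apply/andP; split.
  apply/subset_leq_card/subsetP => v; rewrite !inE /odd_side /fold => sv.
  have := @odd_depth_in_path v.
  by case: ifP => [_ ->|_ _] //; rewrite sv /= ?eqxx ?orbT.
apply: leq_trans (_ : #|[set v | side v] :|: [set v | level v < M]| <= _);
  last exact: leq_card_setU.
apply/subset_leq_card/subsetP => v; rewrite !inE /odd_side /fold.
have := @odd_depth_in_path v; case: ifP => [lt_v -> // |_ _].
  case: (side v) => //= /eqP; move: lt_v; rewrite /depth_in_path.
  by case: (cut _); lia.
by case: (side v) => //=; lia.
Qed.

Lemma piece_ball v : v \in ball G (level v) (piece v).
Proof.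
rewrite /piece; elim: (level v) => [|k IH]; first by rewrite inE.
rewrite iterS; set w := iter k par v in IH *.
have [w0|w_gt0] := posnP (dep w).
  by rewrite par_root //; apply: (subsetP (subset_ball _ _ (leqnSn k))).
have [wp _] := parP w_gt0.
rewrite -add1n; apply: ball_trans IH.
by apply: (@ballS _ _ 0 _ (par w)); [rewrite inE | rewrite adj_sym].
Qed.

End Cut.

Lemma card_piece n (G : sgraph 'I_n) par dep L o Delta u :
    (forall x, 0 < dep x -> adj G x (par x) /\ dep x = (dep (par x)).+1) ->
    (forall x, dep x = 0 -> par x = x) -> max_degree G <= Delta -> 0 < L ->
  #|[set v | val (piece par dep L o v) == u]| <= Delta.+1 ^ L.
Proof.
move=> parP par_root le_D L_gt0.
have [lt_un|le_nu] := ltnP u n; last first.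
  rewrite (_ : [set _ | _] = set0) ?cards0 //; apply/setP => v; rewrite !inE.
  by apply/negP => /eqP e; have := ltn_ord (piece par dep L o v); rewrite /= e; lia.
apply: leq_trans (card_ball L (Ordinal lt_un) le_D).
apply/subset_leq_card/subsetP => v; rewrite inE => /eqP e.
have -> : Ordinal lt_un = piece par dep L o v by apply: val_inj.
apply: subsetP (piece_ball parP par_root L o v); apply: subset_ball.
by rewrite ltnW // ltn_pmod.
Qed.

(** Here f is the size of the colour class of M before the repair, and a counts the vertices in the
    first M levels of the pieces, the only ones that the repair may affect. *)
Lemma balanced_hom n (G : sgraph 'I_n) M L Delta : is_tree G ->
    max_degree G <= Delta -> 1 < M -> ~~ odd M -> M < L ->
  exists h a f, [/\ cycle_hom G M h, a * L <= n * M,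
    f <= n./2 <= f + Delta.+1 ^ L, f <= filling M h M <= f + a
  & forall j, 0 < j < M -> filling M h j <= a].
Proof.
move=> tree le_D M_gt1 M_even ltML.
have [par [dep [edge_par parP par_root]]] := rooted_tree tree.
have [o sparse] := exists_sparse_offset dep (ltnW M_gt1) (ltnW ltML).
rewrite card_ord in sparse.
pose F b t := #|[set v | side par dep L o t b v]|.
have F0 b : F b 0 = #|[set v | odd (dep v) (+) b]|.
  by apply: eq_card => v; rewrite !inE /side addbF.
(* At t = n all pieces are exchanged, which complements the colour class. *)
have Fn b : F b n = n - F b 0.
  have eqn := cardsC [set v | odd (dep v) (+) b].
  rewrite card_ord in eqn; rewrite F0 -[X in X - _]eqn addKn.
  by apply: eq_card => v; rewrite !inE /side ltn_ord addbT.
have [b le_F0] : exists b, F b 0 <= n./2.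
  have : F false 0 + F true 0 = n.
    have eqn := cardsC [set v | odd (dep v) (+) false].
    rewrite card_ord in eqn; rewrite !F0 -[RHS]eqn; congr addn.
    by apply: eq_card => v; rewrite !inE addbF addbT.
  case: (leqP (F false 0) n./2) => [|lt]; first by exists false.
  by exists true; lia.
have step u : F b u.+1 <= F b u + Delta.+1 ^ L.
  apply: leq_trans (leq_add (leqnn _) (card_piece o u parP par_root le_D _)); last by lia.
  apply: leq_trans (leq_card_setU _ _).
  apply/subset_leq_card/subsetP => v; rewrite !inE /side ltnS leq_eqVlt.
  by case: eqP => _ /=; rewrite ?orbT ?orbF.
have le_Fn : n./2 <= F b n by rewrite Fn; lia.
have [t le_F ge_F] := discrete_ivt le_F0 le_Fn step.
exists (fold par dep M L o t b), #|[set v | level dep L o v < M]|, (F b t).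
split=> //; [exact: fold_hom|by rewrite le_F| |].
- exact: (filling_fold_M parP par_root).
- by move=> j j_in; exact: filling_fold_lt.
Qed.

(** * Exact fibres *)

(* [sum_weight] makes class j large enough for the C vertices it may receive from
   each dig at a higher level; the weight 2 at M bounds the number of digs there. *)
Definition weight (C M j : nat) : nat := 2 * C.+1 ^ (M - j).

Lemma sum_weight C M i : i <= M ->
  C * (\sum_(i.+1 <= j < M.+1) weight C M j) + 2 = weight C M i.
Proof.
move=> le_i; have -> : i = M - (M - i) by rewrite subKn.
move: (leq_subr i M); elim: (M - i) => [|k IH] le_k.
  by rewrite subn0 big_geq // /weight subnn muln0.
have e : M - k = (M - k.+1).+1 by lia.
rewrite big_ltn; last by lia.
rewrite mulnDr -addnA -e IH; last by lia.
by rewrite /weight !subKn ?(ltnW le_k) // expnS; nia.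
Qed.

(* The last weight, of class M, gives the classes on its side a total weight that
   exceeds half of [modulus] by 1.  Class 0 takes the remaining vertices. *)
Definition blowup_weights (C M : nat) : seq nat :=
  rcons [seq weight C M j | j <- index_iota 1 M]
    ((C * \sum_(1 <= j < M) weight C M j).+3
     - \sum_(1 <= j < M | odd j) weight C M j).

(** Being larger than C times the middle weights, it guarantees a free centre for every dig. *)
Definition modulus (C M : nat) : nat :=
  2 * (C * \sum_(1 <= j < M) weight C M j).+2.

Lemma exact_filling Delta M : 1 < M -> ~~ odd M ->
  let C := Delta.+1 ^ M.+1 in
  exists n0, forall n (T : sgraph 'I_n), n0 <= n -> is_tree T -> max_degree T <= Delta ->
  exists2 h, cycle_hom T M h
    & forall j, 0 < j <= M -> filling M h j =
       (if j == M then (modulus C M)./2.+1 else weight C M j) * (n %/ modulus C M).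
Proof.
move=> M_gt1 M_even C; set E := modulus C M; set W := \sum_(1 <= j < M) weight C M j.
have C_gt0 : 0 < C by rewrite expn_gt0.
set H := (C * W).+2; have eE : E = 2 * H by [].
have eH : E./2 = H by rewrite eE mul2n doubleK.
(* This L makes the repairs so rare that 2a <= q; the bound on n makes q exceed the rounding error H
   and the imbalance R. *)
pose L := 4 * M * E; pose R := Delta.+1 ^ L.
exists (E * (2 * H + R + 1)) => n T le_n tree le_D; set q := n %/ E.
have E_gt0 : 0 < E by [].
have le_q : 2 * H + R + 1 <= q by rewrite leq_divRL // mulnC.
have n_eq : n = q * E + n %% E := divn_eq n E.
have lt_r : n %% E < E by rewrite ltn_mod.
have ltML : M < L by rewrite /L; nia.
have [h0 [a [f [h0_hom le_a /andP[f_le le_f] /andP[f_leM leM_f] lt_a]]]] :=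
  balanced_hom tree le_D M_gt1 M_even ltML.
rewrite -/R in le_f.
have {}le_a : 2 * a <= q.
  have : a * (4 * E) <= n.
    by rewrite -(@leq_pmul2r M) ?(ltnW M_gt1) //; move: le_a; rewrite /L; nia.
  by nia.
have le_half : n./2 <= H * q + H by nia.
have ge_half : H * q <= n./2 by nia.
rewrite eH; apply: (@fill_exactly _ T M Delta _ h0) => //.
- by case: tree.
- rewrite card_ord; nia.
- rewrite card_ord big_nat (eq_bigr (fun j => weight C M j * q)); last first.
    by move=> j j_in; case: eqP => //; lia.
  rewrite -big_nat -big_distrl -/W -/C /= mulnAC [W * C]mulnC.
  apply: leq_trans (_ : E * q <= n); last by rewrite mulnC leq_divM.
  by rewrite ltn_pmul2r; [rewrite eE /H; lia | lia].
move=> i /andP[i_gt0 le_iM]; rewrite -/C.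
have [->|ne_iM] := eqVneq i M; first by rewrite big_geq // muln0 addn0; nia.
have lt_iM : i < M by rewrite ltn_neqAle ne_iM.
set S := \sum_(_ <= j < _) _.
have le_S : S <= (\sum_(i.+1 <= j < M.+1) weight C M j) * q.
  rewrite big_distrl /=; apply: leq_sum => j _; case: eqP => [->|_]; last exact: leq_subr.
  (* The deficit at M is at most q + R <= 2q. *)
  by rewrite /weight subnn expn0 muln1 mulSn; lia.
(* The summand 2 in [sum_weight] pays for the at most a <= q vertices that class i holds already. *)
have := sum_weight C (ltnW lt_iM); move: le_S; move: (\sum_(_ <= j < _) _) => Z le_S <-.
have := lt_a i; rewrite i_gt0 lt_iM => /(_ isT) le_fi.
have : C * S <= C * (Z * q) by rewrite leq_mul2l le_S orbT.
by rewrite mulnDl -mulnA; lia.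
Qed.

Lemma cadj_rot M a b : a <= M -> b <= M -> cadj M a b ->
  cadj M (if a == 0 then M else a.-1) (if b == 0 then M else b.-1).
Proof. by case: a b => [|a] [|b] /=; rewrite /cadj; lia. Qed.

Lemma card_ord_count n (P : pred nat) : #|[set i : 'I_n | P i]| = count P (iota 0 n).
Proof. by rewrite -val_enum_ord count_map cardsE cardE size_filter enumT. Qed.

(** The fillings determine all fibres: the one at M less the odd middle classes gives class M, and
    what remains is class 0. Equal fibre sizes then allow matching the vertices class by class. *)
Lemma blowup_contains n (T : sgraph 'I_n) C M (h : 'I_n -> nat) (G : sgraph 'I_n) :
    0 < C -> 1 < M -> ~~ odd M -> cycle_hom T M h ->
    (forall j, 0 < j <= M -> filling M h j =
       (if j == M then (modulus C M)./2.+1 else weight C M j) * (n %/ modulus C M)) ->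
    (forall i j : 'I_n, adj G i j
       = cadj M (label (n %/ modulus C M) (blowup_weights C M) i.+1)
                (label (n %/ modulus C M) (blowup_weights C M) j.+1)) ->
  contains G T.
Proof.
move=> C_gt0 M_gt1 M_even h_hom fill adjG; set vs := blowup_weights C M in adjG.
set q := n %/ modulus C M in fill adjG.
set W := \sum_(1 <= j < M) weight C M j.
set Wo := \sum_(1 <= j < M | odd j) weight C M j.
have eH : (modulus C M)./2 = (C * W).+2 by rewrite /modulus mul2n doubleK.
have le_Wo : Wo <= W by rewrite /W (bigID odd) leq_addr.
have eq_sum (P : pred nat) : \sum_(1 <= j < M | P j) filling M h j
    = (\sum_(1 <= j < M | P j) weight C M j) * q.
  rewrite big_distrl big_nat_cond [RHS]big_nat_cond; apply: eq_bigr => j /andP[j_in _].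
  by rewrite fill; [case: eqP => //; lia | lia].
have card_M : #|[set v | h v == M]| = ((C * W).+3 - Wo) * q.
  have := fill M; rewrite leqnn eqxx eH (ltnW M_gt1) => /(_ isT).
  rewrite /filling eqxx mulnBl => <-; rewrite -eq_sum -sum_filling.
  rewrite -(cardsID [set v | h v == M] [set v | odd_side M (h v)]).
  have -> : [set v | odd_side M (h v)] :&: [set v | h v == M] = [set v | h v == M].
    by apply/setP => v; rewrite !inE /odd_side; case: eqP; rewrite ?orbT ?andbF.
  have -> : [set v | odd_side M (h v)] :\: [set v | h v == M]
      = [set v | odd (h v) && (0 < h v < M)].
    by apply/setP => v; rewrite !inE /odd_side; have := h_hom.1 v; lia.
  by rewrite addnK.
have card_0 : #|[set v | h v == 0]| + W * q + #|[set v | h v == M]| = n.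
  have := eq_sum predT; rewrite -/W -sum_filling => <-.
  have := cardsC [set v | 0 < h v]; rewrite card_ord => eqn.
  rewrite -[RHS]eqn -(cardsID [set v | h v == M] [set v | 0 < h v]).
  have -> : ~: [set v | 0 < h v] = [set v | h v == 0].
    by apply/setP => v; rewrite !inE; lia.
  have -> : [set v | 0 < h v] :&: [set v | h v == M] = [set v | h v == M].
    by apply/setP => v; rewrite !inE; lia.
  have -> : [set v | 0 < h v] :\: [set v | h v == M]
      = [set v | predT (h v) && (0 < h v < M)].
    by apply/setP => v; rewrite !inE /=; have := h_hom.1 v; lia.
  by lia.
have size_vs : size vs = M by rewrite size_rcons size_map size_iota; lia.
have sum_vs : sumn vs = W + ((C * W).+3 - Wo).
  by rewrite /vs /blowup_weights -cats1 sumn_cat /= addn0 sumnE big_map.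
have nth_vs j : nth 0 vs j = if j < M.-1 then weight C M j.+1
    else if j == M.-1 then (C * W).+3 - Wo else 0.
  rewrite nth_rcons size_map size_iota subn1; case: ltnP => // lt_j.
  by rewrite (nth_map 0) ?size_iota ?subn1 // nth_iota ?subn1.
(* Class 0 comes last in the row of blocks, which rotates the cycle by one. *)
pose lab v := if h v == 0 then M else (h v).-1.
have [v|s [s_inj lab_s]] :=
    @perm_of_counts n lab (fun i => label q vs i.+1) _.
  rewrite (card_ord_count n (fun i => label q vs i.+1 == v)) count_label; last first.
    by rewrite sum_vs mulnDl -card_M; lia.
  rewrite size_vs nth_vs; have [lt_vM|le_Mv] := ltnP v M.
    have [lt_v|le_v] := ltnP v M.-1.
      have := fill v.+1; rewrite /filling; case: eqP => [|_]; first by lia.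
      move=> <-; last by lia.
      by apply: eq_card => x; rewrite !inE /lab; case: ifP; lia.
    have -> : v = M.-1 by lia.
    rewrite eqxx -card_M.
    by apply: eq_card => x; rewrite !inE /lab; case: ifP; lia.
  have [->|ne_v] := eqVneq v M.
    rewrite sum_vs mulnDl -card_M -[X in X - _]card_0 -addnA addnK.
    by apply: eq_card => x; rewrite !inE /lab; have := h_hom.1 x; case: ifP; lia.
  apply/eqP; rewrite cards_eq0; apply/eqP/setP => x; rewrite !inE /lab.
  by have := h_hom.1 x; case: ifP; lia.
exists s; split=> // x y xy; rewrite adjG -!lab_s.
by apply: cadj_rot; [exact: h_hom.1 | exact: h_hom.1 | exact: h_hom.2].
Qed.

Theorem theorem1p14 (Delta r : nat) (hr : 1 <= r) :
  exists G : forall n : nat, sgraph 'I_n,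
    (exists n0 : nat, forall n : nat, n0 <= n ->
       tree_universal n Delta (G n) /\ no_short_odd_cycle (2 * r + 1) (G n))
    /\ explicitly_constructed G.
Proof.
(* The cycle has M + 1 = 2r + 3 vertices, the least odd number above 2r + 1. *)
pose M := 2 * r + 2.
have M_gt1 : 1 < M by rewrite /M; lia.
have M_even : ~~ odd M by rewrite /M; lia.
pose C := Delta.+1 ^ M.+1; pose vs := blowup_weights C M.
pose class n (i : 'I_n) := label (n %/ modulus C M) vs i.+1.
pose G n := @SGraph 'I_n (fun i j => cadj M (class n i) (class n j))
  (fun i j => cadj_sym M _ _) (fun i => cadj_irr (ltnW M_gt1) _).
have size_vs : size vs = M by rewrite size_rcons size_map size_iota; lia.
exists G; split; last first.
  by apply: (@adj_computable (modulus C M) M vs G).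
have [n0 fill] := exact_filling Delta M_gt1 M_even.
exists n0 => n le_n; split.
  move=> T tree le_D; have [h h_hom h_fill] := fill n T le_n tree le_D.
  by apply: (blowup_contains (G := G n) _ M_gt1 M_even h_hom h_fill); rewrite ?expn_gt0.
move=> c c_cycle odd_c le_c.
have class_le (i : 'I_n) : class n i <= M by rewrite -size_vs label_le.
by apply: (no_short_odd_closed_walk class_le (G := G n) _ c_cycle odd_c) => //; lia.
Qed.
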